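(* Let $M$ be a matroid on a ground set $E$ with $n=|E|\geq 1$ elements. Then $$\mathrm{ehr}_M'(0)=\mathrm{rk}(M)\,H_{n-1}-\sum_{\emptyset\subsetneq A\subsetneq E}\frac{\mathrm{rk}(M)-\mathrm{rk}(A)}{(n-1)\binom{n-2}{|A|-1}},$$ where the sum runs over all nonempty proper subsets $A$ of $E$.
   Context: Matroids are on finite ground sets; identify $E$ with $\{1,\dots,n\}$. $\mathrm{rk}(A)$ is the rank of $A\subseteq E$ in $M$, and $\mathrm{rk}(M)=\mathrm{rk}(E)$. For $A\subseteq E$ let $\mathsf{e}_A=\sum_{i\in A}\mathsf{e}_i\in\{0,1\}^n$ be the indicator vector. The matroid polytope is $\mathscr{P}_M=\mathrm{conv}\{\mathsf{e}_B : B\text{ is a basis of }M\}\subset\mathbb{R}^n$. The Ehrhart polynomial $\mathrm{ehr}_M\in\mathbb{Q}[t]$ is the unique polynomial with $\mathrm{ehr}_M(k)=|\mathbb{Z}^n\cap k\mathscr{P}_M|$ for every integer $k\geq 0$; $\mathrm{ehr}_M'(0)$ is its derivative at $0$, i.e. its linear coefficient. $H_k=1+\frac12+\dots+\frac1k$ are the harmonic numbers, with $H_0=0$. *)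

(* Defs.v *)
From HB Require Import structures.
From mathcomp Require Import all_boot all_order all_algebra.
From mathcomp Require Import boolp classical_sets functions cardinality reals.
From mathcomp Require Import convex.

Set Implicit Arguments.
Unset Strict Implicit.
Unset Printing Implicit Defensive.

Import Order.TTheory GRing.Theory Num.Theory.

Local Open Scope classical_set_scope.
Local Open Scope card_scope.
Local Open Scope ring_scope.

Record matroid (E : finType) := Matroid {
  indep : {set {set E}};
  indep0 : finset.set0 \in indep;
  indepS : forall I J : {set E},
    I \subset J -> J \in indep -> I \in indep;
  indep_augment : forall I J : {set E},
    I \in indep -> J \in indep -> (#|I| < #|J|)%N ->
    exists2 x : E, x \in (J :\: I)%SET & (x |: I)%SET \in indep
}.

Definition bases (E : finType) (M : matroid E) : {set {set E}} :=
  [set B : {set E} | maxset [pred I : {set E} | I \in indep M] B]%SET.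

Definition rk (E : finType) (M : matroid E) (A : {set E}) : nat :=
  \max_(I in indep M | I \subset A) #|I|.

(* Coordinate i of R^n, n = #|E|, is attached to the element enum_val i of E. *)
Definition indicator (R : realType) (E : finType) (A : {set E}) :
  'rV[R]_#|E| := \row_i (enum_val i \in A)%:R.

Definition conv_hull (R : realType) (V : lmodType R) (S : set V) : set V :=
  smallest (@convex_set R V) S.

Definition matroid_polytope (R : realType) (E : finType) (M : matroid E) :
  set 'rV[R]_#|E| :=
  conv_hull [set indicator R B | B in [set B : {set E} | B \in bases M]].
Arguments matroid_polytope R {E} M.

Definition dilate (R : realType) (V : lmodType R) (k : nat) (P : set V) :
  set V := [set k%:R *: x | x in P].

Definition lattice_points (R : realType) (n : nat) (P : set 'rV[R]_n) :
  set 'rV[int]_n := [set z | P (map_mx intr z)].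

(* The cardinal of the set of lattice points is expressed by equipotence with
   `I_m = {0, ..., m - 1}, so that its finiteness is part of the property. *)
Definition is_ehrhart_polynomial (R : realType) (E : finType) (M : matroid E)
  (p : {poly rat}) : Prop :=
  forall k : nat,
    exists2 m : nat,
      lattice_points (dilate k (matroid_polytope R M)) #= `I_m
      & p.[k%:R] = m%:R.

Lemma ehrhart_polynomial_unique (R : realType) (E : finType) (M : matroid E)
    (p q : {poly rat}) :
  is_ehrhart_polynomial R M p -> is_ehrhart_polynomial R M q -> p = q.
Proof.
move=> hp hq; apply/eqP; rewrite -subr_eq0; apply/negPn/negP => pq_neq0.
have pq_root k : root (p - q) (k%:R : rat).
  have [m mA pm] := hp k; have [m' mA' qm] := hq k.
  have mm' : m = m'.
    by apply/card_eq_II; apply: card_eq_trans mA'; rewrite card_eq_sym.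
  by rewrite rootE !hornerE pm qm mm' subrr.
pose s := [seq (k%:R : rat) | k <- iota 0 (size (p - q))].
have : (size s < size (p - q)%R)%N.
  apply: max_poly_roots => //; first by apply/allP => _ /mapP[k _ ->].
  by rewrite map_inj_uniq ?iota_uniq// => i j /eqP; rewrite eqr_nat => /eqP.
by rewrite size_map size_iota ltnn.
Qed.

Definition harmonic_number (k : nat) : rat := \sum_(1 <= i < k.+1) i%:R^-1.

(* Main.v *)
(* The number N(f) of lattice points of the base polytope of a polymatroid f
   satisfies a numerical form of Brion's formula: for generic weights w there are
   universal polynomials p_s, indexed by orderings s of E, such that N(f) is the
   sum of the p_s(<w, v_s(f)>), where v_s(f) is the greedy vertex of f in the
   order s.  As v_s(f) is linear in f, the linear coefficient of k |-> N(k f) is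
   a linear functional of f.  Such a functional is determined by its values on
   the rank functions of the standard simplices on nonempty A, for which
   N(k f) = 'C(k + #|A| - 1, #|A| - 1) has linear coefficient H_(#|A| - 1), and
   the right-hand side of the theorem is a linear functional with the same
   values.  By Edmonds' description of the matroid polytope, the lattice points
   of its k-th dilate are those of the base polytope of k times the rank. *)

Require Import Defs.
From HB Require Import structures.
From mathcomp Require Import all_boot all_order all_algebra.
From mathcomp Require Import reals interval_inference.
From mathcomp Require boolp classical_sets functions cardinality convex.
From mathcomp Require Import ring lra zify.

Set Implicit Arguments.
Unset Strict Implicit.
Unset Printing Implicit Defensive.

Import Order.TTheory GRing.Theory Num.Theory.

Local Open Scope ring_scope.

(** * Lattice points of base polytopes of polymatroids *)

(** The rising factorials [B n] with step [a] have every degree, and the backward difference sends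
    [B n.+1] to [n.+1 * a] times [B n]; cancelling leading terms yields [P]. *)
Lemma poly_antidifference (F : numFieldType) (a : F) (p : {poly F}) :
  a != 0 -> exists P : {poly F}, forall y, P.[y] - P.[y - a] = p.[y].
Proof.
move=> a0.
pose B n : {poly F} := \prod_(i < n) ('X + (i%:R * a)%:P).
have sB n : size (B n) = n.+1.
  rewrite /B (eq_bigr (fun i : 'I_n => 'X - (- (i%:R * a))%:P)); last first.
    by move=> i _; rewrite polyCN opprK.
  by rewrite size_prod_XsubC /index_enum -enumT size_enum_ord.
have diffB n y : (B n.+1).[y] - (B n.+1).[y - a] = (n.+1%:R * a) * (B n).[y].
  have -> : (B n.+1).[y] = (B n).[y] * (y + n%:R * a).
    by rewrite /B big_ord_recr /= !hornerE.
  have -> : (B n.+1).[y - a] = (y - a) * (B n).[y].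
    rewrite /B big_ord_recl /= !hornerE; congr (_ * _).
    rewrite !horner_prod; apply: eq_bigr => i _; rewrite !hornerE /=.
    by rewrite /bump /= natrD; ring.
  by rewrite -natr1; ring.
have [n] := ubnP (size p); elim: n p => // n IHn p; rewrite ltnS => szp.
have [->|p0] := eqVneq p 0.
  by exists 0 => y; rewrite !horner0 subrr.
have sp : (0 < size p)%N by rewrite lt0n size_poly_eq0.
pose k := (size p).-1; pose c := lead_coef p / lead_coef (B k).
have lB0 : lead_coef (B k) != 0 by rewrite lead_coef_eq0 -size_poly_eq0 sB.
have [|P hP] := IHn (p - c *: B k).
  apply: leq_trans szp; rewrite -[in leqRHS](prednK sp) ltnS; apply/leq_sizeP => j.
  rewrite -/k leq_eqVlt => /predU1P[<-|kj]; rewrite coefB coefZ.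
    have -> : (B k)`_k = lead_coef (B k) by rewrite lead_coefE sB.
    by rewrite /c divfK // lead_coefE subrr.
  rewrite (leq_sizeP p j _ j) // ?(leq_sizeP (B k) j _ j) ?sB ?mulr0 ?subr0 //.
  by rewrite -(prednK sp).
exists (P + (c / (k.+1%:R * a)) *: B k.+1) => y.
have k0 : k.+1%:R != 0 :> F by rewrite pnatr_eq0.
have {}hP : P.[y] = P.[y - a] + p.[y] - c * (B k).[y].
  by move: (hP y); rewrite !hornerE => /eqP; rewrite subr_eq => /eqP ->; ring.
have -> : p.[y] = P.[y] - P.[y - a] + c * (B k).[y] by rewrite hP; ring.
have := diffB k y; rewrite !hornerE => /eqP; rewrite subr_eq => /eqP ->.
by field; rewrite a0 addrC natr1 k0.
Qed.

(** The base polytope of [f] consists of the [z] whose sum over each [A] is at most [f A], with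
    equality at the whole ground set. *)
Definition polymatroid (E : finType) (f : {set E} -> nat) : Prop :=
  [/\ f set0 = 0%N,
      forall A B : {set E}, A \subset B -> (f A <= f B)%N
    & forall A B : {set E}, (f (A :|: B) + f (A :&: B) <= f A + f B)%N].

(* The rank function of the slice [z x = t] of the base polytope of f. *)
Definition slice (E : finType) (f : {set E} -> nat) (x : E) (t : nat)
  (A : {set E}) : nat := minn (f A) (f (x |: A) - t).

Definition update (E : finType) (z : {ffun E -> nat}) (x : E) (t : nat) :
  {ffun E -> nat} := [ffun i => if i == x then t else z i].

(** The bounds on [t] are the least and greatest values of coordinate [x] on the base polytope of
    [f] restricted to [x :: s']; coordinates outside the list are 0. *)
Fixpoint base_points (E : finType) (s : seq E) (f : {set E} -> nat) :
    seq {ffun E -> nat} :=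
  if s is x :: s' then
    [seq update z x t
       | t <- index_iota (f (x |: [set:: s']) - f [set:: s']) (f [set x]).+1,
         z <- base_points s' (slice f x t)]
  else [:: [ffun=> 0%N]].

(* [order_weight w f A s] is the w-weight of the vertex of the base polytope of
   the contraction f / A produced by the greedy algorithm in the order s. *)
Fixpoint order_weight (E : finType) (w : E -> rat) (f : {set E} -> nat)
    (A : {set E}) (s : seq E) : rat :=
  if s is y :: s' then
    w y * ((f (y |: A))%:R - (f A)%:R) + order_weight w f (y |: A) s'
  else 0.

(** * Expansion of the point count over greedy vertices *)

Section OrderExpansion.

Variables (E : finType) (w : E -> rat).
Hypothesis w_inj : injective w.
Implicit Types (f : {set E} -> nat) (A B : {set E}) (s : seq E).

(** Diminishing returns: submodularity for [B] and [x |: A], whose intersection contains [A]. *)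
Lemma polymatroid_marginal f x A B : polymatroid f -> A \subset B ->
  (f (x |: B) + f A <= f B + f (x |: A))%N.
Proof.
case=> _ fmono fsub AB; apply: leq_trans (fsub _ _).
have -> : B :|: (x |: A) = x |: B by rewrite setUCA (setUidPl AB).
by rewrite leq_add2l fmono // finset.subsetI AB finset.subsetUr.
Qed.

(** For submodularity, each choice of the terms attaining the minima at [A] and [B] calls for one
    instance of submodularity of [f]. The bound on [t] keeps the truncated subtractions exact. *)
Lemma slice_polymatroid f x t : polymatroid f -> (t <= f [set x])%N ->
  polymatroid (slice f x t).
Proof.
move=> pf tx; have [f0 fmono fsub] := pf.
have tle A : (t <= f (x |: A))%N.
  by apply: (leq_trans tx); apply: fmono; apply: finset.subsetUl.
split=> [|A B AB|A B]; rewrite /slice.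
- by rewrite f0 min0n.
- by have := fmono _ _ AB; have := fmono _ _ (finset.setUS [set x] AB); lia.
- have h1 := fsub A B; have h2 := fsub (x |: A) (x |: B).
  have h3 := fsub A (x |: B); have h4 := fsub (x |: A) B.
  rewrite -finset.setUUr -finset.setUIr in h2.
  rewrite setUCA in h3; rewrite -finset.setUA in h4.
  have h3' : (f (A :&: B) <= f (A :&: (x |: B)))%N.
    by apply: fmono; apply: finset.setIS; apply: finset.subsetUr.
  have h4' : (f (A :&: B) <= f ((x |: A) :&: B))%N.
    by apply: fmono; apply: finset.setSI; apply: finset.subsetUr.
  have := tle A; have := tle B; have := tle (A :|: B); have := tle (A :&: B).
  by lia.
Qed.

(** Marginals of [x] decrease along [s], so from [A] on the minimum in [slice] is its second term;
    the constant shift by [t] cancels in the differences. *)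
Lemma order_weight_slice f x t A s : polymatroid f ->
  (f (x |: A) - f A <= t <= f (x |: A))%N ->
  order_weight w (slice f x t) A s = order_weight w f (x |: A) s.
Proof.
move=> pf; have [_ fmono _] := pf.
elim: s A => //= y s IHs A /andP[At tA].
have m1 := polymatroid_marginal x pf (finset.subsetUr [set y] A).
have m2 := fmono _ _ (finset.setUS [set x] (finset.subsetUr [set y] A)).
have m3 := fmono _ _ (finset.subsetUr [set y] A).
rewrite IHs; last by lia.
rewrite [in RHS]setUCA /slice; congr (w y * _ + _).
have -> : minn (f (y |: A)) (f (x |: (y |: A)) - t) = (f (x |: (y |: A)) - t)%N.
  by lia.
have -> : minn (f A) (f (x |: A) - t) = (f (x |: A) - t)%N by lia.
by rewrite !natrB; [ring|lia|lia].
Qed.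

(* As t grows past each marginal of x along s, the greedy vertex of the slice
   traces a segment whose ends are greedy vertices of f for two consecutive
   insertions of x into s, so that the sum over t telescopes. *)
Lemma insertion_expansion x s (p : {poly rat}) : x \notin s ->
  exists2 F : seq (seq E * {poly rat}), all (fun q => perm_eq q.1 (x :: s)) F
  & forall f A (c : rat), polymatroid f ->
    \sum_(f (x |: (A :|: [set:: s])) - f (A :|: [set:: s])
             <= t < (f (x |: A) - f A).+1)
       p.[c + w x * t%:R + order_weight w (slice f x t) A s]
    = \sum_(q <- F) q.2.[c + order_weight w f A q.1].
Proof.
elim: s => [_|y s IHs].
  exists [:: ([:: x], p)]; first by rewrite /= perm_refl.
  move=> f A c [_ fmono _]; rewrite set_nil finset.setU0 big_nat1 big_seq1 /=.
  by rewrite natrB ?fmono ?finset.subsetUr // !addr0.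
rewrite inE negb_or => /andP[xy /IHs[F /allP Fs FE]].
(* Injectivity of [w] makes the step nonzero, so the antidifference [P] exists. *)
have a0 : w x - w y != 0 by rewrite subr_eq0 (inj_eq w_inj).
have [P hP] := poly_antidifference p a0.
(* Either [y] comes first and [x] is inserted further on, or a boundary term of the telescoping sum
   puts [x] just before or just after [y]. *)
exists ([seq (y :: q.1, q.2) | q <- F] ++
   [:: (x :: y :: s, P); (y :: x :: s, - P)]).
  have swap : perm_eq [:: y, x & s] [:: x, y & s].
    by apply/permP => a /=; rewrite addnCA.
  rewrite all_cat all_map /= perm_refl swap /= andbT.
  by apply/allP => q /Fs /= qs; apply: perm_trans swap; rewrite perm_cons.
move=> f A c pf; have [_ fmono _] := pf.
set A' := y |: A.
have sAA' : A \subset A' by apply: finset.subsetUr.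
have AsE : A :|: [set:: y :: s] = A' :|: [set:: s].
  by rewrite set_cons finset.setUCA finset.setUA.
rewrite AsE; set B := A' :|: _.
have sA'B : A' \subset B by apply: finset.subsetUl.
have m1 := polymatroid_marginal x pf sAA'.
have m2 := polymatroid_marginal x pf sA'B.
have m3 := fmono _ _ (finset.subsetUr [set x] A).
have m4 := fmono _ _ (finset.subsetUr [set x] A').
have m5 := fmono _ _ (finset.setUS [set x] sAA').
(* Split at the marginal of [x] over [A']: up to it the slice agrees with [f] on [A] and [A'], so
   the induction hypothesis applies at [A']. *)
rewrite (big_cat_nat (n := (f (x |: A') - f A').+1)) /=; [|lia|lia].
rewrite big_cat big_map /=; congr (_ + _).
  pose c' := c + w y * ((f A')%:R - (f A)%:R).
  under [RHS]eq_bigr do rewrite addrA -/A' -/c'.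
  rewrite -FE //; apply: eq_big_nat => t /andP[_ tA'].
  have sA' : slice f x t A' = f A' by rewrite /slice; lia.
  have sA : slice f x t A = f A by rewrite /slice; lia.
  by rewrite /= -/A' sA sA' /c'; congr (p.[_]); ring.
rewrite big_cons big_seq1 /= -/A' -/A' [y |: (x |: A)]setUCA -/A' hornerN.
(* Beyond it the argument of [p] is affine in [t] with slope [w x - w y], so each term is a
   difference of values of [P]. *)
pose C := c + w y * ((f (x |: A'))%:R - (f A)%:R) + order_weight w f (x |: A') s.
pose g (t : nat) := P.[C + (w x - w y) * t%:R].
rewrite big_add1 /=.
rewrite (eq_big_nat _ _ (F2 := fun t => g t.+1 - g t)); last first.
  move=> t /andP[tA' tA]; rewrite /= -/A' order_weight_slice //; last by lia.
  have sA' : slice f x t.+1 A' = (f (x |: A') - t.+1)%N by rewrite /slice; lia.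
  have sA : slice f x t.+1 A = f A by rewrite /slice; lia.
  rewrite /g -hP sA sA' natrB /C; last by lia.
  by congr (P.[_] - P.[_]); rewrite -natr1; ring.
rewrite telescope_sumr; last by lia.
rewrite /g /C !natrB; [|lia|lia].
by congr (P.[_] - P.[_]); ring.
Qed.

(* Brion's formula with the poles summed out.  The free constant c is what makes
   the induction go through: slicing at [z x = t] shifts the argument by
   [w x * t]. *)
Lemma base_points_expansion s : uniq s ->
  exists2 F : seq (seq E * {poly rat}), all (fun q => perm_eq q.1 s) F
  & forall f (c : rat), polymatroid f ->
    (size (base_points s f))%:R
    = \sum_(q <- F) q.2.[c + order_weight w f set0 q.1].
Proof.
elim: s => [_|x s IHs /= /andP[xs /IHs[F Fs FE]]].
  exists [:: ([::], 1)] => // f c _; by rewrite big_seq1 hornerC.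
suff [G Gs GE] : exists2 G : seq (seq E * {poly rat}),
    all (fun q => perm_eq q.1 (x :: s)) G
    & forall f c, polymatroid f ->
      \sum_(f (x |: [set:: s]) - f [set:: s] <= t < (f [set x]).+1)
        \sum_(q <- F) q.2.[c + w x * t%:R + order_weight w (slice f x t) set0 q.1]
      = \sum_(q <- G) q.2.[c + order_weight w f set0 q.1].
  exists G => // f c pf; rewrite -GE // size_allpairs_dep.
  rewrite sumnE big_map natr_sum; apply: eq_big_nat => t /andP[_ tx].
  by apply: FE; apply: slice_polymatroid.
elim: F Fs {FE} => [_|[r p] F IHF /= /andP[rs /IHF[G Gs GE]]].
  exists [::] => // f c _; rewrite big_nil; apply: big1 => t _.
  by rewrite big_nil.
have [|H Hr HE] := @insertion_expansion x r p; first by rewrite (perm_mem rs).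
exists (H ++ G).
  rewrite all_cat Gs andbT; apply/allP => q /(allP Hr) qr.
  by apply: perm_trans qr _; rewrite perm_cons.
move=> f c pf; rewrite big_cat /= -HE // -GE // !finset.set0U finset.setU0.
have -> : [set:: r] = [set:: s] by apply/setP => i; rewrite !inE (perm_mem rs).
have [-> _ _] := pf; rewrite subn0 -big_split /=.
by apply: eq_bigr => t _; rewrite big_cons.
Qed.

End OrderExpansion.

(** * The linear coefficient as a linear functional *)

Lemma poly_eq_on_posnat (F : numFieldType) (p q : {poly F}) :
  (forall k, p.[k.+1%:R] = q.[k.+1%:R]) -> p = q.
Proof.
move=> pq; apply/eqP; rewrite -subr_eq0; apply/negPn/negP => pq0.
pose s : seq F := [seq k.+1%:R | k <- iota 0 (size (p - q))].
have : (size s < size (p - q)%R)%N.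
  apply: max_poly_roots => //.
    by apply/allP => _ /mapP[k _ ->]; rewrite rootE !hornerE pq subrr.
  by rewrite map_inj_uniq ?iota_uniq// => i j /eqP; rewrite eqr_nat => /eqP[].
by rewrite size_map size_iota ltnn.
Qed.

Lemma polymatroid_scale (E : finType) (f : {set E} -> nat) (k : nat) :
  polymatroid f -> polymatroid (fun A => k * f A)%N.
Proof.
case=> f0 fmono fsub; split=> [|A B AB|A B]; first by rewrite f0 muln0.
  by rewrite leq_mul2l fmono ?orbT.
by rewrite -!mulnDr leq_mul2l fsub orbT.
Qed.

Lemma order_weight_scale (E : finType) (w : E -> rat) (f : {set E} -> nat)
    (k : nat) (A : {set E}) (s : seq E) :
  order_weight w (fun S => k * f S)%N A s = k%:R * order_weight w f A s.
Proof.
elim: s A => [|y s IHs] A /=; first by rewrite mulr0.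
by rewrite IHs !natrM; ring.
Qed.

Lemma order_weight_linear (E : finType) (w : E -> rat) (A : {set E})
    (s : seq E) :
  exists d : {set E} -> rat,
    forall f, order_weight w f A s = \sum_S d S * (f S)%:R.
Proof.
elim: s A => [|y s IHs] A.
  by exists (fun=> 0) => f; rewrite big1 // => S _; rewrite mul0r.
have [d dE] := IHs (y |: A).
exists (fun S => w y * ((S == y |: A)%:R - (S == A)%:R) + d S) => f /=.
under eq_bigr do rewrite mulrDl -mulrA mulrBl.
rewrite big_split /= -dE -mulr_sumr sumrB; congr (w y * (_ - _) + _).
  rewrite (bigD1 (y |: A)) //= eqxx mul1r big1 ?addr0 // => S /negPf ->.
  by rewrite mul0r.
rewrite (bigD1 A) //= eqxx mul1r big1 ?addr0 // => S /negPf ->.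
by rewrite mul0r.
Qed.

(** Scaling [f] by [k] scales each greedy weight by [k], so each term of the expansion contributes
    its derivative at 0 times a weight linear in [f]. As [w] and the expansion depend only on [E],
    so does [d]. *)
Lemma ehrhart_linear_coefficient (E : finType) :
  exists d : {set E} -> rat, forall (f : {set E} -> nat) (p : {poly rat}),
    polymatroid f ->
    (forall k, p.[k.+1%:R]
       = (size (base_points (enum E) (fun A => k.+1 * f A)%N))%:R) ->
    p^`().[0] = \sum_S d S * (f S)%:R.
Proof.
pose w (i : E) : rat := (enum_rank i)%:R.
have w_inj : injective w.
  by move=> i j /eqP; rewrite eqr_nat => /eqP/val_inj/enum_rank_inj.
have [F _ FE] := base_points_expansion w_inj (enum_uniq E).
have [d dE] : exists d : {set E} -> rat, forall f,
    \sum_(q <- F) q.2^`().[0] * order_weight w f set0 q.1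
    = \sum_S d S * (f S)%:R.
  elim: F {FE} => [|q F [d dE]].
    by exists (fun=> 0) => f; rewrite big_nil big1 // => S _; rewrite mul0r.
  have [d' d'E] := order_weight_linear w set0 q.1.
  exists (fun S => q.2^`().[0] * d' S + d S) => f.
  rewrite big_cons dE d'E mulr_sumr -big_split /=.
  by apply: eq_bigr => S _; ring.
exists d => f p pf pE; rewrite -dE.
pose P := \sum_(q <- F) (q.2 \Po (order_weight w f set0 q.1 *: 'X)).
have -> : p = P.
  apply: poly_eq_on_posnat => k.
  rewrite pE (FE _ 0); last exact: polymatroid_scale.
  rewrite /P horner_sum; apply: eq_bigr => q _.
  by rewrite horner_comp !hornerE order_weight_scale mulrC.
rewrite /P raddf_sum /= horner_sum; apply: eq_bigr => q _.
by rewrite deriv_comp derivZ derivX hornerM horner_comp !hornerZ hornerX hornerC mulr0 mulr1.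
Qed.

(** Correctness of the enumeration. By induction on [s]: at [t = z x], the inequalities for sets
    avoiding and containing [x] are the two terms of the minimum in [slice]. *)
Lemma mem_base_points (E : finType) (s : seq E) (f : {set E} -> nat)
    (z : {ffun E -> nat}) : polymatroid f -> uniq s ->
  z \in base_points s f <->
  [/\ forall A : {set E}, A \subset s -> (\sum_(i in A) z i <= f A)%N,
      (\sum_(i in s) z i)%N = f [set:: s]
    & forall i, i \notin s -> z i = 0%N].
Proof.
elim: s f z => [|x s IHs] f z pf.
  move=> _; have [f0 _ _] := pf.
  rewrite /= inE; split=> [/eqP->|[_ _ z0]].
    split=> [A|//|i _]; last by rewrite ffunE.
      by move=> _; rewrite big1 // => i _; rewrite ffunE.
    by rewrite set_nil f0 big1 // => i _; rewrite ffunE.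
  by apply/eqP/ffunP => i; rewrite ffunE z0.
move=> /= /andP[xs us]; have [f0 fmono fsub] := pf.
have sumx (y : E -> nat) : (\sum_(i in x :: s) y i = y x + \sum_(i in s) y i)%N.
  rewrite (bigD1 x) ?mem_head //=; congr (_ + _)%N; apply: eq_bigl => i.
  by rewrite inE; case: eqVneq => //= [->|]; rewrite ?(negPf xs) ?andbT.
have sumx' (y : E -> nat) (A : {set E}) : x \notin A ->
    (\sum_(i in x |: A) y i = y x + \sum_(i in A) y i)%N.
  by move=> xA; rewrite big_setU1.
have cons_sub (A : {set E}) : A \subset s -> x |: A \subset x :: s.
  move=> /subsetP As; apply/subsetP => i /setU1P[->|/As]; first exact: mem_head.
  by rewrite inE => ->; rewrite orbT.
have xA (A : {set E}) : A \subset s -> x \notin A.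
  by move=> /subsetP As; apply: contra xs => /As.
have sub_s (A : {set E}) : A \subset s -> A \subset x :: s.
  by move=> /subsetP As; apply/subsetP => i /As; rewrite inE => ->; rewrite orbT.
split=> [zin|[zle zs z0]].
  have {zin z} [t [y [lo hi yin ->]]] : exists (t : nat) (y : {ffun E -> nat}),
      [/\ (f (x |: [set:: s]) - f [set:: s] <= t)%N, (t <= f [set x])%N,
          y \in base_points s (slice f x t) & z = update y x t].
    have /allpairsPdep[t [y [+ yin ->]]] := zin.
    by rewrite mem_index_iota ltnS => /andP[lo hi]; exists t, y.
  have pfib := slice_polymatroid pf hi.
  have [yle ys y0] := (IHs _ y pfib us).1 yin.
  have ztx : update y x t x = t by rewrite ffunE eqxx.
  have zty (A : {set E}) : A \subset s ->
      (\sum_(i in A) update y x t i = \sum_(i in A) y i)%N.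
    move=> /xA xnA; apply: eq_bigr => i iA; rewrite ffunE.
    by case: eqVneq iA xnA => [->->|].
  have ztys : (\sum_(i in s) update y x t i = \sum_(i in s) y i)%N.
    apply: eq_bigr => i iA; rewrite ffunE.
    by case: eqVneq iA xs => [->->|].
  split=> [A Axs||i].
  - have As : A :\ x \subset s.
      apply/subsetP => i /setD1P[ix /(subsetP Axs)].
      by rewrite inE (negPf ix).
    have [iA|niA] := boolP (x \in A).
      rewrite -(setD1K iA) sumx' ?xA // ztx zty //.
      have := yle _ As; rewrite /slice.
      have := fmono _ _ (finset.subsetUl [set x] (A :\ x)).
      by lia.
    have As' : A \subset s.
      apply/subsetP => i iA; apply: (subsetP As); rewrite in_setD1 iA andbT.
      by apply: contraNneq niA => <-.
    rewrite zty //; apply: leq_trans (yle _ As') _.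
    by rewrite /slice geq_minl.
  - rewrite sumx ztx ztys ys /slice set_cons.
    have := fmono _ _ (finset.subsetUl [set x] [set:: s]).
    by lia.
  - rewrite inE negb_or => /andP[ix /y0 yi].
    by rewrite ffunE (negPf ix).
have zx : (z x <= f [set x])%N.
  have := zle [set x]; rewrite big_set1; apply.
  by apply/subsetP => i /set1P ->; apply: mem_head.
have Ss : [set:: s] \subset s by apply/subsetP => i; rewrite inE.
have sumS : (\sum_(i in [set:: s]) z i = \sum_(i in s) z i)%N.
  by apply: eq_bigl => i; rewrite inE.
rewrite sumx set_cons in zs.
have zS := zle _ (sub_s _ Ss); rewrite sumS in zS.
apply/allpairsPdep; exists (z x), (update z x 0%N); split=> /=.
- by rewrite mem_index_iota ltnS zx andbT leq_subLR -zs addnC leq_add2r.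
- apply/IHs => //; first exact: slice_polymatroid.
  have zty (A : {set E}) : A \subset s ->
      (\sum_(i in A) update z x 0%N i = \sum_(i in A) z i)%N.
    move=> /xA xnA; apply: eq_bigr => i iA; rewrite ffunE.
    by case: eqVneq iA xnA => [->->|].
  have ztys : (\sum_(i in s) update z x 0%N i = \sum_(i in s) z i)%N.
    apply: eq_bigr => i iA; rewrite ffunE.
    by case: eqVneq iA xs => [->->|].
  split=> [A As||i].
  - rewrite zty // /slice leq_min zle ?sub_s //=.
    by have := zle _ (cons_sub _ As); rewrite sumx' ?xA //; lia.
  - by rewrite ztys /slice; lia.
  - move=> si; rewrite ffunE; case: eqVneq => // ix.
    by rewrite z0 // inE (negPf ix).
- by apply/ffunP => i; rewrite !ffunE; case: eqVneq => [->|].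
Qed.

(** Makes [size] a true count. Points of a slice vanish at [x], so [update] loses no information. *)
Lemma base_points_uniq (E : finType) (s : seq E) (f : {set E} -> nat) :
  polymatroid f -> uniq s -> uniq (base_points s f).
Proof.
elim: s f => //= x s IHs f pf /andP[xs us].
have slicep t : t \in index_iota (f (x |: [set:: s]) - f [set:: s]) (f [set x]).+1 ->
    polymatroid (slice f x t).
  rewrite mem_index_iota ltnS => /andP[_ hi]; exact: slice_polymatroid.
apply: allpairs_uniq_dep => [|t /slicep pt|].
- exact: iota_uniq.
- exact: IHs.
move=> _ _ /allpairsPdep[t [y [/slicep pt yt ->]]]
  /allpairsPdep[t' [y' [/slicep pt' yt' ->]]] /= /ffunP e.
have tt' : t = t' by have := e x; rewrite !ffunE eqxx.
rewrite -tt' in yt' *; congr existT; apply/ffunP => i.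
have := e i; rewrite !ffunE; case: eqVneq => // -> _.
have [_ _ ->] := (mem_base_points y pt us).1 yt => //.
by have [_ _ ->] := (mem_base_points y' pt us).1 yt'.
Qed.

(** * Simplices and the linear coefficient *)

(* The rank function of the standard simplex on the coordinates in A. *)
Definition meets (E : finType) (A S : {set E}) : nat := A :&: S != set0.

Lemma meets_polymatroid (E : finType) (A : {set E}) : polymatroid (meets A).
Proof.
rewrite /meets; split=> [|S T ST|S T].
- by rewrite finset.setI0 eqxx.
- case: (eqVneq (A :&: T)) => [AT|_]; last by case: eqP.
  by have := finset.setIS A ST; rewrite AT subset0 => ->.
- case: (eqVneq (A :&: S)) => [AS|AS]; case: (eqVneq (A :&: T)) => [AT|AT] /=.
  + rewrite finset.setIUr AS AT finset.setU0 eqxx.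
    by rewrite finset.setIA AS finset.set0I eqxx.
  + by rewrite finset.setIA AS finset.set0I eqxx addn0 leq_b1.
  + by rewrite finset.setICA AT finset.setI0 eqxx addn0 addn0 leq_b1.
  + by rewrite (leq_add (leq_b1 _) (leq_b1 _)).
Qed.

Lemma eq_base_points (E : finType) (s : seq E) (f g : {set E} -> nat) :
  f =1 g -> base_points s f = base_points s g.
Proof.
elim: s f g => //= x s IHs f g fg; rewrite !fg.
congr flatten; apply: eq_map => t; congr map; apply: IHs => A.
by rewrite /slice !fg.
Qed.

Lemma sum_bin_diagonal (k m : nat) :
  (\sum_(j < k.+1) 'C(j + m, m) = 'C(k + m.+1, m.+1))%N.
Proof.
elim: k => [|k IHk]; first by rewrite big_ord_recl big_ord0 !add0n !binn.
by rewrite big_ord_recr /= IHk addSnnS [in RHS]addSn binS.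
Qed.

(** Stars and bars: fixing a coordinate [x] of [A] at [t] leaves the simplex dilated by [k - t], and
    the hockey-stick identity sums over [t]. If [A] misses [s], the truncated predecessor gives 1,
    for the zero vector. *)
Lemma size_base_points_meets (E : finType) (s : seq E) (A : {set E}) (k : nat) :
  uniq s ->
  size (base_points s (fun S => k * meets A S)%N)
  = 'C(k + #|A :&: [set:: s]|.-1, #|A :&: [set:: s]|.-1).
Proof.
elim: s k => [|x s IHs] k /=.
  by rewrite set_nil finset.setI0 cards0 bin0.
move=> /andP[xs us]; rewrite size_allpairs_dep sumnE big_map.
set B := [set:: s]; have xB : x \notin B by rewrite inE.
have -> : [set:: x :: s] = x |: B by rewrite set_cons.
have [xA|nxA] := boolP (x \in A); last first.
  have m0 : meets A [set x] = 0%N.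
    by rewrite /meets; case: eqVneq => // /set0Pn[i /setIP[+ /set1P ix]]; rewrite ix (negPf nxA).
  have mU S : meets A (x |: S) = meets A S.
    rewrite /meets finset.setIUr; congr (nat_of_bool (_ != _)).
    by move: m0; rewrite /meets; case: eqVneq => // -> _; rewrite finset.set0U.
  have -> : A :&: (x |: B) = A :&: B.
    apply/setP => i; rewrite !inE; case: eqVneq => //= ->.
    by rewrite (negPf nxA).
  rewrite mU subnn m0 muln0 big_nat1 -IHs //.
  congr size; apply: eq_base_points => S.
  by rewrite /slice mU subn0 minnn.
have mU S : meets A (x |: S) = 1%N.
  by rewrite /meets (introT (set0Pn _)) //; exists x; rewrite !inE eqxx xA.
have m1 : meets A [set x] = 1%N by rewrite -(mU set0) finset.setU0.
have cU : #|A :&: (x |: B)| = #|A :&: B|.+1.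
  have -> : A :&: (x |: B) = x |: (A :&: B).
    by apply/setP => i; rewrite !inE; case: eqVneq => //= ->; rewrite xA.
  by rewrite cardsU1 !inE (negPf xs) andbF.
have slE t : slice (fun S => k * meets A S)%N x t =1 (fun S => (k - t) * meets A S)%N.
  move=> S; rewrite /slice mU muln1 /meets.
  by case: (_ != _); rewrite ?muln1 ?muln0 ?min0n // (minn_idPr (leq_subr _ _)).
rewrite cU mU m1 muln1 /=.
under eq_bigr do rewrite (eq_base_points s (slE _)) IHs //.
rewrite /meets; have [AB0|AB0] := eqVneq (A :&: B) set0.
  by rewrite muln0 subn0 AB0 cards0 big_nat1 subnn addn0 !bin0.
rewrite muln1 subnn big_mkord (reindex_inj rev_ord_inj) /=.
have := AB0; rewrite -cards_eq0; case: #|_| => // c _.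
rewrite -sum_bin_diagonal; apply: eq_bigr => i _.
by rewrite subSS subKn // -ltnS.
Qed.

(** * Harmonic numbers and sums of inverse binomial coefficients *)

Lemma harmonic_numberS (m : nat) :
  harmonic_number m.+1 = harmonic_number m + m.+1%:R^-1.
Proof. by rewrite /harmonic_number big_nat_recr. Qed.

(** The polynomial is the product of the ['X / i + 1] for [1 <= i <= m]; all factors are 1 at 0, so
    each adds [1 / i] to the derivative there. *)
Lemma bin_polynomial (m : nat) :
  exists2 p : {poly rat}, forall k : nat, p.[k%:R] = 'C(k + m, m)%:R
  & p^`().[0] = harmonic_number m.
Proof.
elim: m => [|m [p pE dp]].
  exists 1 => [k|]; first by rewrite hornerC bin0.
  by rewrite derivC horner0 /harmonic_number big_nil.
have m0 : m.+1%:R != 0 :> rat by rewrite pnatr_eq0.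
exists (p * (m.+1%:R^-1 *: 'X + 1)) => [k|].
  rewrite hornerM pE !hornerE; apply: (mulIf m0).
  have /(congr1 (fun i : nat => i%:R : rat)) := mul_bin_diag (k + m).+1 m.
  by rewrite addnS /= !natrM -!natr1 natrD => h; rewrite [RHS]mulrC -h; field; rewrite natr1.
rewrite derivM derivD derivZ derivX derivC addr0 hornerD !hornerM dp.
have := pE 0%N; rewrite add0n binn => ->.
by rewrite !hornerE harmonic_numberS; ring.
Qed.

Lemma sum_subsetsU1 (E : finType) (V : nmodType) (x : E) (C : {set E})
    (F : {set E} -> V) : x \notin C ->
  \sum_(S : {set E} | S \subset x |: C) F S
  = \sum_(S : {set E} | S \subset C) (F S + F (x |: S)).
Proof.
move=> xC; rewrite (bigID (fun S : {set E} => x \notin S)) /= big_split /=.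
congr (_ + _).
  apply: eq_bigl => S; apply/andP/idP => [[SxC xS]|SC].
    apply/subsetP => i iS; have := subsetP SxC _ iS.
    by rewrite !inE => /predU1P[ix|//]; rewrite -ix iS in xS.
  split; last by apply: contra xC; apply/subsetP.
  by apply: subset_trans SC _; apply: finset.subsetUr.
rewrite (reindex_onto (fun S => x |: S) (fun S => S :\ x)) /=; last first.
  by move=> S /andP[_]; rewrite negbK => /setD1K.
apply: eq_bigl => S; apply/idP/idP => [/andP[/andP[SxC _] /eqP <-]|SC].
  by rewrite -(setU1K xC) finset.setSD.
have xS : x \notin S by apply: contra xC; apply/subsetP.
by rewrite finset.setUS // setU1K // eqxx !inE eqxx.
Qed.

(* Rests on 1/(N 'C(N-1,s)) + 1/(N 'C(N-1,s+1)) = 1/((N-1) 'C(N-2,s)). *)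
Lemma sum_subsets_inv_bin (E : finType) (C : {set E}) (N : nat) :
  (#|C| < N)%N ->
  \sum_(S : {set E} | S \subset C) (N%:R * 'C(N.-1, #|S|)%:R)^-1
  = (N - #|C|)%:R^-1 :> rat.
Proof.
have [n] := ubnP #|C|; elim: n C N => // n IHn C N; rewrite ltnS => Cn CN.
have [->|/set0Pn[x xC]] := eqVneq C set0.
  rewrite (big_pred1 set0) ?cards0 ?bin0 ?mulr1 ?subn0 //.
  by move=> S /=; rewrite subset0.
rewrite -(setD1K xC) sum_subsetsU1 ?setD11 //.
have Cx := cardsD1 x C; rewrite xC add1n in Cx.
rewrite setD1K // Cx in Cn CN *.
case: N CN => [|[|M]] // CN.
have -> : (M.+2 - #|C :\ x|.+1)%N = (M.+1 - #|C :\ x|)%N by [].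
rewrite -IHn //; apply: eq_bigr => S SC /=.
have xS : x \notin S by apply: contraTN SC => xS; apply/subsetPn; exists x; rewrite ?setD11.
rewrite cardsU1 xS add1n.
have SM : (#|S| <= M)%N by apply: leq_trans (subset_leq_card SC) _.
have /(congr1 (fun i : nat => i%:R : rat)) := mul_bin_diag M.+1 #|S|.
have /(congr1 (fun i : nat => i%:R : rat)) := mul_bin_down M.+1 #|S|.
have b0 : 'C(M, #|S|)%:R != 0 :> rat by rewrite pnatr_eq0 -lt0n bin_gt0.
have b1 : 'C(M.+1, #|S|)%:R != 0 :> rat by rewrite pnatr_eq0 -lt0n bin_gt0 leqW.
have b2 : 'C(M.+1, #|S|.+1)%:R != 0 :> rat by rewrite pnatr_eq0 -lt0n bin_gt0.
have M1 : M.+1%:R != 0 :> rat by rewrite pnatr_eq0.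
have M2 : M.+2%:R != 0 :> rat by rewrite pnatr_eq0.
have S1 : #|S|.+1%:R != 0 :> rat by rewrite pnatr_eq0.
have MS : (M.+1 - #|S|)%:R != 0 :> rat by rewrite pnatr_eq0 subn_eq0 -ltnNge.
rewrite /= !natrM => e1 e2.
have -> : 'C(M.+1, #|S|)%:R = M.+1%:R * 'C(M, #|S|)%:R / (M.+1 - #|S|)%:R :> rat.
  by rewrite e1 mulrC mulKf.
have -> : 'C(M.+1, #|S|.+1)%:R = M.+1%:R * 'C(M, #|S|)%:R / #|S|.+1%:R :> rat.
  by rewrite e2 mulrC mulKf.
rewrite !invfM !invrK -!mulrA -mulrDr.
have -> : M.+1%:R^-1 * ('C(M, #|S|)%:R^-1 * (M.+1 - #|S|)%:R)
    + M.+1%:R^-1 * ('C(M, #|S|)%:R^-1 * #|S|.+1%:R)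
    = M.+1%:R^-1 * 'C(M, #|S|)%:R^-1 * M.+2%:R :> rat.
  rewrite !mulrA -mulrDr -natrD; congr (_ * _%:R); lia.
by rewrite mulrC mulfK.
Qed.

(** The subsets of [C] containing a fixed [x] contribute [1 / (N - #|C| + 1)] by the preceding sum;
    removing elements one by one telescopes into harmonic numbers. *)
Lemma sum_nonempty_subsets_inv_bin (E : finType) (C : {set E}) (N : nat) :
  (#|C| <= N)%N ->
  \sum_(S : {set E} | (S != set0) && (S \subset C))
     (N%:R * 'C(N.-1, #|S|.-1)%:R)^-1
  = harmonic_number N - harmonic_number (N - #|C|).
Proof.
have [n] := ubnP #|C|; elim: n C => // n IHn C; rewrite ltnS => Cn CN.
have [->|/set0Pn[x xC]] := eqVneq C set0.
  rewrite cards0 subn0 subrr big1 // => S; rewrite subset0.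
  by case: eqVneq.
have Cx := cardsD1 x C; rewrite xC add1n in Cx.
rewrite Cx in Cn CN *.
rewrite (eq_bigl (fun S : {set E} => (S \subset x |: (C :\ x)) && (S != set0))); last first.
  by move=> S; rewrite setD1K // andbC.
rewrite big_mkcondr sum_subsetsU1 ?setD11 //= big_split /= -big_mkcondr /=.
rewrite (eq_bigl (fun S : {set E} => (S != set0) && (S \subset C :\ x))); last first.
  by move=> S; rewrite andbC.
rewrite IHn; [|lia|lia].
rewrite (eq_bigr (fun S : {set E} => (N%:R * 'C(N.-1, #|S|)%:R)^-1)); last first.
  move=> S SC.
  have xS : x \notin S.
    by apply: contraTN SC => xS; apply/subsetPn; exists x; rewrite ?setD11.
  rewrite (introT (set0Pn _)); last by exists x; rewrite setU11.
  by rewrite cardsU1 xS.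
rewrite sum_subsets_inv_bin //.
have -> : (N - #|C :\ x|)%N = (N - #|C :\ x|.+1).+1 by lia.
by rewrite harmonic_numberS; ring.
Qed.

(** [meets setT - meets (~: S)] is the indicator of the nonempty subsets of [S], so induction on the
    size of [S] isolates [d S]. *)
Lemma meets_sums_inj (E : finType) (d : {set E} -> rat) :
  (forall A : {set E}, A != set0 -> \sum_S d S * (meets A S)%:R = 0) ->
  forall S : {set E}, S != set0 -> d S = 0.
Proof.
move=> dA S; have [n] := ubnP #|S|; elim: n S => // n IHn S; rewrite ltnS => Sn S0.
have {}dA A : \sum_S d S * (meets A S)%:R = 0.
  have [->|/dA//] := eqVneq A set0; apply: big1 => T _.
  by rewrite /meets finset.set0I eqxx mulr0.
have : \sum_T d T * ((meets setT T)%:R - (meets (~: S) T)%:R) = 0.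
  by under eq_bigr do rewrite mulrBr; rewrite sumrB !dA subrr.
rewrite (bigD1 S) //= big1 ?addr0 => [|T TS].
  by rewrite /meets finset.setTI S0 finset.setIC finset.setICr eqxx subr0 mulr1.
have [->|T0] := eqVneq T set0.
  by rewrite /meets !finset.setI0 eqxx subrr mulr0.
rewrite /meets finset.setTI T0 finset.setIC -finset.setDE.
have [/eqP TS0|_] := eqVneq (T :\: S) set0; last by rewrite subrr mulr0.
rewrite IHn ?mul0r //; apply: leq_trans Sn; apply: proper_card.
by rewrite properEneq TS -setD_eq0.
Qed.

Lemma polymatroid_ehrhart_linear_coefficient (E : finType)
    (f : {set E} -> nat) (p : {poly rat}) :
  polymatroid f ->
  (forall k, p.[k.+1%:R]
     = (size (base_points (enum E) (fun A => k.+1 * f A)%N))%:R) ->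
  (1 <= #|E|)%N ->
  p^`().[0] =
    (f setT)%:R * harmonic_number (#|E| - 1)
    - \sum_(A : {set E} | (set0 \proper A) && (A \proper setT))
        ((f setT)%:R - (f A)%:R)
        / ((#|E| - 1)%:R * 'C(#|E| - 2, #|A| - 1)%:R).
Proof.
move=> pf pE E1.
pose c (A : {set E}) : rat := ((#|E| - 1)%:R * 'C(#|E| - 2, #|A| - 1)%:R)^-1.
pose proper_nonempty := [pred A : {set E} | (set0 \proper A) && (A \proper setT)].
(* Coefficients of the right-hand side as a linear functional of [f]: the full set collects the
   harmonic number and every [- c B]. *)
pose d' (A : {set E}) : rat :=
  (A == setT)%:R * (harmonic_number (#|E| - 1) - \sum_(B in proper_nonempty) c B)
  + (A \in proper_nonempty)%:R * c A.
have d'E (g : {set E} -> nat) :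
    (g setT)%:R * harmonic_number (#|E| - 1)
    - \sum_(A in proper_nonempty) ((g setT)%:R - (g A)%:R) * c A
    = \sum_A d' A * (g A)%:R.
  under [RHS]eq_bigr do rewrite mulrDl.
  rewrite big_split /= [X in _ = X + _](bigD1 setT) //= eqxx mul1r [X in _ = _ + X + _]big1 => [|A /negPf ->]; last first.
    by rewrite !mul0r.
  rewrite addr0 [X in _ = _ + X](bigID proper_nonempty) /=.
  rewrite [X in _ = _ + (_ + X)]big1 => [|A /negPf]; last first.
    by rewrite unfold_in /= => ->; rewrite !mul0r.
  under eq_bigr do rewrite mulrBl.
  rewrite sumrB -mulr_sumr addr0.
  rewrite [X in _ = _ + X](eq_bigr (fun A => (g A)%:R * c A)); first by ring.
  by move=> A nA; rewrite unfold_in /= nA mul1r mulrC.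
have [d dE] := ehrhart_linear_coefficient E.
rewrite (dE f) //.
have dd' (A : {set E}) : A != set0 -> d A = d' A.
  move=> A0; apply/eqP; rewrite -subr_eq0; apply/eqP; move: A A0.
  apply: (@meets_sums_inj E (fun A => d A - d' A)) => A A0.
  have [q qE dq] := bin_polynomial #|A|.-1.
  under eq_bigr do rewrite mulrBl.
  rewrite sumrB -d'E -(dE (meets A) q); [|exact: meets_polymatroid|]; last first.
    move=> k; rewrite qE size_base_points_meets ?enum_uniq //.
    have -> : [set:: enum E] = setT by apply/setP => i; rewrite !inE mem_enum.
    by rewrite finset.setIT.
  have mT : meets A setT = 1%N by rewrite /meets finset.setIT A0.
  have A1 : (0 < #|A|)%N by rewrite card_gt0.
  have AE := cardsC A.
  rewrite dq mT mul1r.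
  rewrite (eq_bigr (fun B : {set E} => if B \subset ~: A then c B else 0)); last first.
    move=> B _; rewrite /meets.
    have -> : (B \subset ~: A) = (A :&: B == set0).
      by rewrite finset.setIC setI_eq0 disjoints_subset.
    by case: eqVneq; rewrite ?subrr ?subr0 ?mul1r ?mul0r.
  rewrite -big_mkcondr /=.
  rewrite (eq_bigl (fun B : {set E} => (B != set0) && (B \subset ~: A))); last first.
    move=> B; rewrite unfold_in /= proper0.
    have [BA|] := boolP (B \subset ~: A); rewrite ?andbF // !andbT.
    rewrite properT; case: eqVneq => //= B0.
    apply: contraTneq BA => ->; rewrite subTset; apply: contraNneq A0 => AT.
    by rewrite -(finset.setCK A) AT finset.setCT.
  rewrite (eq_bigr (fun B : {set E} =>
    ((#|E| - 1)%:R * 'C((#|E| - 1).-1, #|B|.-1)%:R)^-1)); last first.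
    by move=> B _; rewrite /c !subn1 subn2.
  (* With [N = #|E| - 1] and [C = ~: A], the leading harmonic number cancels and leaves
     [harmonic_number #|A|.-1], as for the simplex. *)
  rewrite sum_nonempty_subsets_inv_bin; last by lia.
  have -> : (#|E| - 1 - #|~: A|)%N = #|A|.-1 by lia.
  by ring.
(* The two functionals may differ at the empty set, where [f] vanishes. *)
rewrite (eq_bigr (fun A => d' A * (f A)%:R)) -?d'E // => A _.
have [->|/dd' -> //] := eqVneq A set0.
by have [-> _ _] := pf; rewrite !mulr0.
Qed.

(** * Matroid rank functions and the matroid polytope *)

Section MatroidRank.

Variables (E : finType) (M : matroid E).
Implicit Types A B I J : {set E}.

Lemma card_indep_le_rk A I : I \in indep M -> I \subset A -> (#|I| <= rk M A)%N.
Proof.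
move=> iI IA; rewrite /rk (bigD1 I) ?iI //=.
exact: leq_maxl.
Qed.

Lemma rk_attained A : exists2 I, I \in indep M & (I \subset A) && (#|I| == rk M A).
Proof.
have [|I /andP[iI IA] rI] := @eq_bigmax_cond _ [pred I | (I \in indep M) && (I \subset A)]
    (fun I : {set E} => #|I|).
  by apply/card_gt0P; exists finset.set0; rewrite inE indep0 finset.sub0set.
by exists I => //; rewrite IA /rk -rI eqxx.
Qed.

Lemma indep_extend A I : I \in indep M -> I \subset A ->
  exists2 J, J \in indep M & [&& I \subset J, J \subset A & #|J| == rk M A].
Proof.
have [n] := ubnP (rk M A - #|I|); elim: n I => // n IHn I; rewrite ltnS => In iI IA.
have := card_indep_le_rk iI IA; rewrite leq_eqVlt => /predU1P[rI|Ir].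
  by exists I; rewrite // subxx IA rI eqxx.
have [K iK /andP[KA /eqP rK]] := rk_attained A.
rewrite -rK in Ir; have [x /setDP[xK xI] ixI] := indep_augment iI iK Ir.
have xIA : x |: I \subset A by rewrite finset.subUset sub1set IA (subsetP KA).
have [|J iJ /and3P[xIJ JA rJ]] := IHn (x |: I) _ ixI xIA.
  by rewrite cardsU1 xI rK in Ir *; lia.
by exists J; rewrite // JA rJ (subset_trans (finset.subsetUr _ _) xIJ).
Qed.

Lemma rk_le_card A : (rk M A <= #|A|)%N.
Proof. by have [I _ /andP[IA /eqP <-]] := rk_attained A; apply: subset_leq_card. Qed.

(** For submodularity, a maximal independent [I] in [A :&: B] extends to a maximal independent [J]
    in [A :|: B]; the independent sets [J :&: A] and [J :&: B] have sizes adding up to at least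
    those of [J] and [I]. *)
Lemma rk_polymatroid : polymatroid (rk M).
Proof.
split=> [|A B AB|A B].
- by apply/eqP; rewrite -leqn0 -(cards0 E) rk_le_card.
- have [I iI /andP[IA /eqP <-]] := rk_attained A.
  by apply: card_indep_le_rk => //; apply: subset_trans AB.
have [I iI /andP[IAB /eqP <-]] := rk_attained (A :&: B).
have IU : I \subset A :|: B.
  apply: (subset_trans IAB); apply: (subset_trans (finset.subsetIl _ _)).
  exact: finset.subsetUl.
have [J iJ /and3P[IJ JAB /eqP <-]] := indep_extend iI IU.
have iJc C : (#|J :&: C| <= rk M C)%N.
  apply: card_indep_le_rk; last exact: finset.subsetIr.
  by apply: indepS iJ; apply: finset.subsetIl.
apply: leq_trans (leq_add (iJc A) (iJc B)).
rewrite -(cardsUI (J :&: A)) -finset.setIUr (finset.setIidPl JAB) leq_add2l.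
by rewrite -finset.setIIr subset_leq_card // finset.subsetI IJ.
Qed.

Lemma rk_setD1 A x : x \in A -> (rk M A <= (rk M (A :\ x)).+1)%N.
Proof.
move=> xA; have [I iI /andP[IA /eqP <-]] := rk_attained A.
apply: leq_trans (_ : #|I :\ x|.+1 <= _)%N.
  by rewrite (cardsD1 x I); case: (x \in I).
rewrite ltnS; apply: card_indep_le_rk; last exact: finset.setSD.
by apply: indepS iI; apply: subsetDl.
Qed.

Lemma basesP B : reflect (B \in indep M /\ #|B| = rk M finset.setT) (B \in bases M).
Proof.
rewrite inE; apply: (iffP maxsetP) => /= -[iB mB]; split=> //.
  have [J iJ /and3P[BJ _ /eqP <-]] := indep_extend iB (finset.subsetT B).
  by rewrite (mB J).
move=> C iC BC; by apply/esym/eqP; rewrite eqEcard BC mB card_indep_le_rk ?finset.subsetT.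
Qed.

Lemma bases_of_card B : (#|B| <= rk M B)%N -> #|B| = rk M finset.setT -> B \in bases M.
Proof.
move=> rB cB; apply/basesP; split=> //.
have [I iI /andP[IB /eqP rI]] := rk_attained B.
by have /eqP <- : I == B by rewrite eqEcard IB rI.
Qed.

End MatroidRank.

(** * Edmonds' description of the matroid polytope *)

Section MatroidPolytope.

Variables (R : realFieldType) (E : finType) (M : matroid E).
Implicit Types (x y : {ffun E -> R}) (A B : {set E}).

(** Nonnegativity is implicit: [x i] is the total minus the sum over the complement of [i], hence at
    least a difference of ranks. *)
Definition rank_feasible x : Prop :=
  (forall A, \sum_(i in A) x i <= (rk M A)%:R)
  /\ \sum_i x i = (rk M finset.setT)%:R.

Definition tight x A : bool := \sum_(i in A) x i == (rk M A)%:R.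

Definition transfer x (i j : E) (a : R) : {ffun E -> R} :=
  [ffun k => x k + a * ((k == i)%:R - (k == j)%:R)].

Lemma sum_transfer x i j a A :
  \sum_(k in A) transfer x i j a k
  = \sum_(k in A) x k + a * ((i \in A)%:R - (j \in A)%:R).
Proof.
have sumE l : \sum_(k in A) (k == l)%:R = (l \in A)%:R :> R.
  rewrite big_mkcond (bigD1 l) //= eqxx big1 ?addr0 => [|k /negPf ->].
    by case: (_ \in _).
  by case: (_ \in _).
rewrite -!sumE -sumrB mulr_sumr -big_split /=.
by apply: eq_bigr => k _; rewrite ffunE.
Qed.

(** Uncrossing: sums over sets are modular and the rank is submodular, so slacks vanishing at [A]
    and [B] vanish at their union and intersection. *)
Lemma tightUI x A B : rank_feasible x -> tight x A -> tight x B ->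
  tight x (A :|: B) && tight x (A :&: B).
Proof.
move=> [xle _] /eqP tA /eqP tB.
have sumUI : \sum_(i in A :|: B) x i + \sum_(i in A :&: B) x i
    = \sum_(i in A) x i + \sum_(i in B) x i.
  rewrite ![\sum_(_ in _) _]big_mkcond -!big_split /=; apply: eq_bigr => i _.
  by rewrite !inE; do 2!case: (i \in _) => /=; rewrite ?addr0 ?add0r.
have [_ _ rsub] := rk_polymatroid M.
have := rsub A B; rewrite -(ler_nat R) !natrD.
have := xle (A :|: B); have := xle (A :&: B); rewrite /tight.
move: sumUI; rewrite tA tB => sumUI ? ? ?.
by apply/andP; split; apply/eqP; lra.
Qed.

Lemma tight0 x : tight x finset.set0.
Proof. by have [r0 _ _] := rk_polymatroid M; rewrite /tight big_set0 r0. Qed.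

Lemma tightT x : rank_feasible x -> tight x finset.setT.
Proof.
case=> _ xT; rewrite /tight -xT; apply/eqP/eq_bigl => i; exact: finset.in_setT.
Qed.

(** [a] is the least slack among the sets containing [i] but not [j], the only ones whose sums grow.
    A minimizer becomes tight, and tight sets stay tight since they contain both or neither of [i]
    and [j]. *)
Lemma transfer_until_tight x i j : rank_feasible x -> i != j ->
  (forall A, tight x A -> (i \in A) = (j \in A)) ->
  exists a, [/\ 0 < a, rank_feasible (transfer x i j a)
    & (#|[set A | ~~ tight (transfer x i j a) A]| < #|[set A | ~~ tight x A]|)%N].
Proof.
move=> [xle xT] ij tij.
pose slack A := (rk M A)%:R - \sum_(k in A) x k.
have Pi : (i \in [set i]) && (j \notin [set i]) by rewrite !inE eqxx eq_sym.
case: (@Order.TotalTheory.arg_minP _ _ _ _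
  (fun A : {set E} => (i \in A) && (j \notin A)) slack Pi) => D /andP[iD jD] minD.
have ntD : ~~ tight x D by apply: contra jD => /tij <-.
exists (slack D); have slack_gt0 : 0 < slack D.
  by rewrite lt0r subr_eq0 eq_sym ntD subr_ge0 xle.
split=> //.
  split=> [A|]; last first.
    have -> : \sum_k transfer x i j (slack D) k = \sum_(k in finset.setT) transfer x i j (slack D) k.
      by apply: eq_bigl => k; rewrite inE.
    rewrite sum_transfer !inE subrr mulr0 addr0 -xT.
    by apply: eq_bigl => k; rewrite inE.
  rewrite sum_transfer; have := slack_gt0; have := xle A; have := minD A.
  rewrite /slack; case: (i \in A); case: (j \in A) => /= minDA ? ?;
    by [lra | have := minDA isT; lra].
apply: proper_card; apply/properP; split.
  apply/subsetP => A; rewrite !inE; apply: contra => tA.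
  by rewrite /tight sum_transfer (tij _ tA) subrr mulr0 addr0.
exists D; rewrite !inE ?ntD // negbK /tight sum_transfer iD (negPf jD).
by rewrite /slack /=; apply/eqP; ring.
Qed.

(** Each [x i] is the difference of the ranks of two tight sets [D] and [D :\ i], hence 0 or 1. The
    ones form a basis: their number is at most their rank and equals the rank of [M]. *)
Lemma separated_indicator x : rank_feasible x ->
  (forall i j, i != j -> exists2 A, tight x A & (i \in A) != (j \in A)) ->
  exists2 B, B \in bases M & x = [ffun i => (i \in B)%:R].
Proof.
move=> fx sep; have [xle xT] := fx.
have x01 i : (x i == 0) || (x i == 1).
  have Pi : tight x finset.setT && (i \in finset.setT) by rewrite tightT ?inE.
  case: (arg_minnP (P := fun A : {set E} => tight x A && (i \in A))
    (fun A : {set E} => #|A|) Pi).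
  move=> D /andP[tD iD] minD.
  have subD U : tight x U -> i \in U -> D \subset U.
    move=> tU iU; have /andP[_ tI] := tightUI fx tD tU.
    have := minD (D :&: U); rewrite tI !inE iD iU => /(_ isT) h.
    by apply/finset.setIidPl/eqP; rewrite eqEcard finset.subsetIl.
  have P0 : tight x finset.set0 && (finset.set0 \subset D :\ i).
    by rewrite tight0 finset.sub0set.
  case: (arg_maxnP (P := fun A : {set E} => tight x A && (A \subset D :\ i))
    (fun A : {set E} => #|A|) P0).
  move=> W /andP[tW WD] maxW.
  (* If [j] in [D :\ i] were missing from [W], a tight [U] separating [j] from [i] would contain [j]
     and not [i], by minimality of [D], and [W :|: U :&: D] would be a larger tight set. *)
  have {maxW P0} WE : W = D :\ i.
    apply/eqP; rewrite eqEsubset WD; apply/subsetP => j jDi; apply/negPn/negP => jW.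
    have /andP[ji jD] : (j != i) && (j \in D) by move: jDi; rewrite !inE.
    have [U tU] := sep _ _ ji.
    have [iU|iU] := boolP (i \in U).
      by rewrite (subsetP (subD _ tU iU) _ jD) eqxx.
    rewrite eqbF_neg negbK => jU.
    have /andP[_ tUD] := tightUI fx tU tD.
    have /andP[tWU _] := tightUI fx tW tUD.
    have := maxW (W :|: U :&: D); rewrite tWU finset.subUset WD /=.
    have -> : U :&: D \subset D :\ i.
      by rewrite subsetD1 finset.subsetIr !inE negb_and iU.
    move=> /(_ isT); apply/negP; rewrite -ltnNge; apply: proper_card; apply/properP.
    split; first exact: finset.subsetUl.
    by exists j; rewrite // !inE jU jD orbT.
  move: tW tD; rewrite WE /tight => /eqP tDi /eqP.
  rewrite (big_setD1 i) //= tDi.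
  have := rk_setD1 M iD; have [_ rmono _] := rk_polymatroid M.
  have := rmono _ _ (subsetDl D [set i]).
  rewrite leq_eqVlt => /predU1P[-> _ h|lt le].
    by apply/orP; left; apply/eqP; lra.
  have -> : rk M D = (rk M (D :\ i)).+1 by apply/eqP; rewrite eqn_leq le lt.
  by rewrite -natr1 => h; apply/orP; right; apply/eqP; lra.
pose B := [set i | x i == 1].
have xB i : x i = (i \in B)%:R.
  by rewrite inE; case/orP: (x01 i) => /eqP ->; rewrite ?eqxx // eq_sym oner_eq0.
have sumB A : \sum_(i in A) x i = #|A :&: B|%:R.
  rewrite -sum1_card natr_sum big_mkcond [RHS]big_mkcond /=.
  by apply: eq_bigr => i _; rewrite xB in_setI; case: (i \in A); case: (i \in B).
exists B; last by apply/ffunP => i; rewrite ffunE.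
apply: bases_of_card.
  by rewrite -(ler_nat R) -{1}(finset.setIid B) -sumB.
apply/eqP; rewrite -(eqr_nat R) -xT -{1}(finset.setTI B) -sumB.
by apply/eqP/eq_bigl => i; rewrite inE.
Qed.

(* Edmonds: if a feasible point lies on a face where coordinates i and j are
   still exchangeable, moving along [e_i - e_j] both ways until a new set
   becomes tight writes it as a convex combination of two simpler points. *)
Lemma matroid_polytope_ind (K : {ffun E -> R} -> Prop) :
  (forall B, B \in bases M -> K [ffun i => (i \in B)%:R]) ->
  (forall x y t, 0 <= t <= 1 -> K x -> K y ->
     K [ffun i => t * x i + (1 - t) * y i]) ->
  forall x, rank_feasible x -> K x.
Proof.
move=> Kbases Kconv x.
have [n] := ubnP #|[set A | ~~ tight x A]|.
elim: n x => // n IHn x; rewrite ltnS => xn fx.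
pose sep := [forall i, forall j, (i != j) ==>
  [exists A : {set E}, tight x A && ((i \in A) != (j \in A))]].
have [/forallP s|] := boolP sep.
  have [|B bB ->] := separated_indicator fx; last exact: Kbases.
  move=> i j ij; have /forallP/(_ j)/implyP/(_ ij)/existsP[A /andP[tA nA]] := s i.
  by exists A.
rewrite negb_forall => /existsP[i]; rewrite negb_forall => /existsP[j].
rewrite negb_imply negb_exists => /andP[ij /forallP nsep].
have tij A : tight x A -> (i \in A) = (j \in A).
  by move=> tA; have := nsep A; rewrite tA negbK => /eqP.
have [a [a0 fa na]] := transfer_until_tight fx ij tij.
have [|b [b0 fb nb]] := transfer_until_tight fx _ (fun A tA => esym (tij A tA)).
  by rewrite eq_sym.
have ab_gt0 : 0 < a + b by rewrite addr_gt0.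
have ab0 := lt0r_neq0 ab_gt0.
(* Weights inversely proportional to the moves make [+a] and [-b] along [e_i - e_j] cancel. *)
have -> : x = [ffun k => b / (a + b) * transfer x i j a k
                        + (1 - b / (a + b)) * transfer x j i b k].
  by apply/ffunP => k; rewrite !ffunE; field.
apply: Kconv; last 2 first.
- by apply: IHn => //; apply: leq_trans na xn.
- by apply: IHn => //; apply: leq_trans nb xn.
apply/andP; split; first by apply: divr_ge0; apply: ltW.
by rewrite ler_pdivrMr // mul1r lerDr ltW.
Qed.

End MatroidPolytope.

(** * Lattice points of dilated matroid polytopes *)

Section LatticePoints.

Import boolp classical_sets functions cardinality convex.

Lemma convex_setP (R : numDomainType) (V : lmodType R) (K : set V) :
  @convex_set R V K <->
  forall x y t, 0 <= t <= 1 -> K x -> K y -> K (t *: x + (1 - t) *: y).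
Proof.
split=> [cK x y t /andP[t0 t1] Kx Ky|cK x y t].
  have := cK x y (Itv01 t0 t1); rewrite !in_setE; exact.
by rewrite !in_setE; apply: cK; apply/andP.
Qed.

Lemma card_seq_eq (T : choiceType) (s : seq T) :
  uniq s -> ([set` s] #= `I_(size s))%card.
Proof.
move=> us.
suff /bijPex[f] : exists f, set_bij [set` s]%classic `I_(size s) f.
  exact: pcard_eq f.
exists (index^~ s); split=> [x /=|x y|i /= si]; first by rewrite index_mem.
  rewrite !in_setE /= => xs ys xy.
  by rewrite -(nth_index x xs) xy nth_index.
have x0 : T by case: s us si.
by exists (nth x0 s i); rewrite /= ?mem_nth ?index_uniq.
Qed.

Variables (R : realType) (E : finType) (M : matroid E).

(** The feasible points form a convex set containing the indicators of bases; conversely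
    [matroid_polytope_ind] places each of them in every convex set containing those indicators. *)
Lemma matroid_polytopeP (v : 'rV[R]_#|E|) :
  matroid_polytope R M v <->
  rank_feasible M [ffun i : E => v 0 (enum_rank i)].
Proof.
have coord (A : {set E}) (u : 'rV[R]_#|E|) :
    \sum_(i in A) [ffun i : E => u 0 (enum_rank i)] i
    = \sum_(i in A) u 0 (enum_rank i).
  by apply: eq_bigr => i _; rewrite ffunE.
split.
  pose K := [set u : 'rV[R]_#|E| |
    rank_feasible M [ffun i : E => u 0 (enum_rank i)]]%classic.
  apply: (smallest_sub (X := K)).
    apply/convex_setP => x y t /andP[t0 t1] [xle xT] [yle yT].
    have sumE (P : pred E) : \sum_(i | P i)
        [ffun i : E => (t *: x + (1 - t) *: y) 0 (enum_rank i)] i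
      = t * (\sum_(i | P i) [ffun i : E => x 0 (enum_rank i)] i)
        + (1 - t) * (\sum_(i | P i) [ffun i : E => y 0 (enum_rank i)] i).
      rewrite !mulr_sumr -big_split /=; apply: eq_bigr => i _.
      by rewrite !ffunE !mxE.
    split=> [A|]; rewrite sumE; last by rewrite xT yT; ring.
    have := ler_wpM2l t0 (xle A); have t1' : 0 <= 1 - t by rewrite subr_ge0.
    by have := ler_wpM2l t1' (yle A); lra.
  move=> _ [B /= /basesP[iB cB] <-].
  have indE i : [ffun i => (indicator R B) 0 (enum_rank i)] i = (i \in B)%:R :> R.
    by rewrite ffunE mxE enum_rankK.
  have sumE (A : {set E}) :
      \sum_(i in A) [ffun i => (indicator R B) 0 (enum_rank i)] i = #|A :&: B|%:R :> R.
    rewrite -sum1_card natr_sum big_mkcond [RHS]big_mkcond /=.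
    by apply: eq_bigr => i _; rewrite indE finset.in_setI; case: (i \in A); case: (i \in B).
  split=> [A|].
    rewrite sumE ler_nat; apply: card_indep_le_rk; last exact: finset.subsetIl.
    by apply: indepS iB; apply: finset.subsetIr.
  rewrite -cB -{2}(finset.setTI B) -sumE; apply: eq_bigl => i.
  by rewrite finset.in_setT.
move=> fv K [/convex_setP cK bK].
pose row (x : {ffun E -> R}) : 'rV[R]_#|E| := \row_i x (enum_val i).
have -> : v = row [ffun i : E => v 0 (enum_rank i)].
  by apply/rowP => i; rewrite mxE ffunE enum_valK.
apply: (matroid_polytope_ind (K := fun x => K (row x))) fv.
  move=> B bB; apply: bK; exists B => //.
  by apply/rowP => i; rewrite !mxE ffunE.
move=> x y t t01 Kx Ky.
have -> : row [ffun i => t * x i + (1 - t) * y i] = t *: row x + (1 - t) *: row y.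
  by apply/rowP => i; rewrite !mxE ffunE.
exact: cK.
Qed.

Definition lattice_row (z : {ffun E -> nat}) : 'rV[int]_#|E| :=
  \row_i (z (enum_val i))%:Z.

Lemma lattice_points_matroid_polytope (k : nat) :
  lattice_points (dilate k.+1 (matroid_polytope R M))
  = (lattice_row @` [set` base_points (enum E) (fun A => k.+1 * rk M A)%N])%classic.
Proof.
have pk := polymatroid_scale k.+1 (rk_polymatroid M).
have k0 : k.+1%:R != 0 :> R by rewrite pnatr_eq0.
have ET : [set:: enum E] = finset.setT by apply/setP => i; rewrite !inE mem_enum.
have sumT (z : E -> nat) : (\sum_(i in enum E) z i = \sum_(i in finset.setT) z i)%N.
  by apply: eq_bigl => i; rewrite mem_enum finset.in_setT.
apply/seteqP; split=> [z [y /matroid_polytopeP[yle yT] yz]|_ [z /= + <-]].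
  have yzE i : y 0 (enum_rank i) = (z 0 (enum_rank i))%:~R / k.+1%:R.
    have /rowP/(_ (enum_rank i)) := yz; rewrite !mxE => <-.
    by rewrite mulrC mulKf.
  have sumE (P : pred E) :
      \sum_(i | P i) [ffun i : E => y 0 (enum_rank i)] i
      = (\sum_(i | P i) z 0 (enum_rank i))%:~R / k.+1%:R.
    rewrite rmorph_sum mulr_suml; apply: eq_bigr => i _.
    by rewrite ffunE yzE.
  have zle (A : {set E}) : \sum_(i in A) z 0 (enum_rank i) <= (k.+1 * rk M A)%N%:Z.
    have := yle A; rewrite sumE ler_pdivrMr ?ltr0n // mulrC -natrM.
    by rewrite -[leRHS]/((k.+1 * rk M A)%N%:Z%:~R) ler_int.
  have zT : \sum_i z 0 (enum_rank i) = (k.+1 * rk M finset.setT)%N%:Z.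
    move: yT; rewrite sumE => /(canRL (divfK k0)); rewrite mulrC -natrM.
    by rewrite -[RHS]/((k.+1 * rk M finset.setT)%N%:Z%:~R) => /intr_inj.
  (* The enumeration lists vectors of naturals; nonnegativity comes from comparing the total with
     the bound on the complement of [i]. *)
  have z0 i : 0 <= z 0 (enum_rank i).
    have := zle (~: [set i])%SET; have [_ rmono _] := pk.
    have := rmono _ _ (finset.subsetT (~: [set i])%SET); rewrite -lez_nat -zT.
    rewrite (bigD1 i) //= => le1 le2; have := le_trans le2 le1.
    rewrite [X in X <= _ -> _](eq_bigl (fun j => j != i)) => [|j]; first by rewrite lerDr.
    by rewrite finset.in_setC finset.in_set1.
  pose u : {ffun E -> nat} := [ffun i => `|z 0%R (enum_rank i)|%N].
  have uz i : (u i)%:Z = z 0 (enum_rank i) by rewrite ffunE gez0_abs.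
  have sumu (A : {set E}) : (\sum_(i in A) u i)%N%:Z = \sum_(i in A) z 0 (enum_rank i).
    by rewrite -natz natr_sum; apply: eq_bigr => i _; rewrite natz uz.
  exists u; last by apply/rowP => i; rewrite mxE uz enum_valK.
  apply/mem_base_points => //; first exact: enum_uniq.
  split=> [A _||i]; last by rewrite mem_enum.
    by rewrite -lez_nat sumu.
  rewrite ET sumT; apply/eqP; rewrite -eqz_nat sumu -zT.
  by apply/eqP/eq_bigl => i; rewrite finset.in_setT.
move=> /mem_base_points[||zle zT _] //; first exact: enum_uniq.
exists (k.+1%:R^-1 *: map_mx intr (lattice_row z)); last first.
  by rewrite /= scalerA divff // scale1r.
apply/matroid_polytopeP.
have sumE (P : pred E) :
    \sum_(i | P i) [ffun i : E =>
      (k.+1%:R^-1 *: map_mx intr (lattice_row z)) 0 (enum_rank i)] i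
    = (\sum_(i | P i) z i)%N%:R / k.+1%:R :> R.
  rewrite natr_sum mulr_suml; apply: eq_bigr => i _.
  by rewrite ffunE !mxE enum_rankK mulrC.
split=> [A|]; rewrite sumE.
  rewrite ler_pdivrMr ?ltr0n // mulrC -natrM ler_nat zle //.
  by apply/fintype.subsetP => i _; rewrite mem_enum.
apply/(canLR (mulfK k0)); rewrite mulrC -natrM -ET -zT.
by congr _%:R; apply: eq_bigl => i; rewrite mem_enum.
Qed.

Lemma ehrhart_polynomial_count (p : {poly rat}) (k : nat) :
  is_ehrhart_polynomial R M p ->
  p.[k.+1%:R] = (size (base_points (enum E) (fun A => k.+1 * rk M A)%N))%:R.
Proof.
move=> /(_ k.+1)[m]; rewrite lattice_points_matroid_polytope => mE ->.
have row_inj : injective lattice_row.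
  move=> y z /rowP yz; apply/ffunP => i; have := yz (enum_rank i).
  by rewrite !mxE enum_rankK => -[].
congr _%:R; apply/card_eq_II; rewrite card_eq_sym in mE.
apply: card_eq_trans mE _.
apply: card_eq_trans (inj_card_eq _) (card_seq_eq _).
  by move=> ? ? _ _; apply: row_inj.
apply: base_points_uniq (enum_uniq _).
by apply: polymatroid_scale; apply: rk_polymatroid.
Qed.

End LatticePoints.

Theorem theorem1 (R : realType) (E : finType) (M : matroid E)
    (ehr : {poly rat}) :
  (1 <= #|E|)%N ->
  is_ehrhart_polynomial R M ehr ->
  ehr^`().[0] =
    (rk M [set: E])%:R * harmonic_number (#|E| - 1)
    - \sum_(A : {set E} | (set0 \proper A) && (A \proper [set: E]))
        ((rk M [set: E])%:R - (rk M A)%:R)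
        / ((#|E| - 1)%:R * 'C(#|E| - 2, #|A| - 1)%:R).
Proof.
move=> E1 hehr.
apply: polymatroid_ehrhart_linear_coefficient E1; first exact: rk_polymatroid.
by move=> k; apply: ehrhart_polynomial_count hehr.
Qed.
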